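(* Let $n\ge2$ and let $P\in\mathcal I(n)$ be nonzero and indecomposable. Then $$\operatorname{p-degree}(P)\le (n-1)\,(2N(P)-5).$$
   Context: $S(X)=X_0+X_1+\dots+X_n$. $\mathcal I(n)$ denotes the set of homogeneous polynomials $P\in\mathbb R[X_0,\dots,X_n]$ with $P(X)=0$ whenever $S(X)=0$. $N(P)$ is the number of distinct monomials of $P$ with nonzero coefficient. The p-degree of $P$ is the smallest integer $d$ such that $P=X^\alpha R$ for some monomial $X^\alpha$ and some polynomial $R$ of degree $d$. $P\in\mathcal I(n)$ is indecomposable if one cannot write $P=P_1+P_2$ with $P_1,P_2\in\mathcal I(n)$ both nonzero and having no monomial in common. *)

(* Defs.v *)
From HB Require Import structures.
From mathcomp Require Import all_boot all_order all_algebra.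
Set Implicit Arguments. Unset Strict Implicit. Unset Printing Implicit Defensive.
Import Order.TTheory GRing.Theory Num.Theory.
Local Open Scope ring_scope.

Definition mono (n : nat) := {ffun 'I_n.+1 -> nat}.

Record mpoly (R : realFieldType) (n : nat) := MPoly {
  coef : mono n -> R;
  supp : seq (mono n);
  supp_ok : forall m, coef m != 0 -> m \in supp
}.

Section Defs.
Variables (R : realFieldType) (n : nat).
Implicit Types (P Q : mpoly R n) (m a : mono n).

Definition support P : seq (mono n) := undup [seq m <- supp P | coef P m != 0].

Definition nterms P : nat := size (support P).

Definition mdeg m : nat := (\sum_(i < n.+1) m i)%N.

(* total degree (0 for the zero polynomial) *)
Definition tdeg P : nat := (\max_(m <- support P) mdeg m)%N.

Definition homogeneous P : Prop :=
  exists d, forall m, coef P m != 0 -> mdeg m = d.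

Definition eval P (x : 'I_n.+1 -> R) : R :=
  \sum_(m <- support P) coef P m * \prod_(i < n.+1) x i ^+ m i.

Definition S (x : 'I_n.+1 -> R) : R := \sum_(i < n.+1) x i.

Definition inI P : Prop :=
  homogeneous P /\ forall x, S x = 0 -> eval P x = 0.

Definition nonzero P : Prop := exists m, coef P m != 0.

Definition indecomposable P : Prop :=
  inI P /\
  ~ exists P1 P2 : mpoly R n,
      [/\ inI P1 /\ inI P2, nonzero P1, nonzero P2,
          (forall m, coef P m = (coef P1 m + coef P2 m)%R) &
          (forall m, coef P1 m = 0 \/ coef P2 m = 0)].

Definition is_mono_mul P a Q : Prop :=
  forall m, coef P m =
    if [forall i, (a i <= m i)%N] then coef Q [ffun i => (m i - a i)%N] else 0.

Definition pdeg_attained P (d : nat) : Prop :=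
  exists a Q, is_mono_mul P a Q /\ tdeg Q = d.

Definition is_pdegree P (d : nat) : Prop :=
  pdeg_attained P d /\ forall d', pdeg_attained P d' -> (d <= d')%N.

End Defs.

(* Main.v *)
Require Import Defs.
From HB Require Import structures.
From mathcomp Require Import all_boot all_order all_algebra.
From mathcomp Require Import finalg zify.
Import Order.TTheory GRing.Theory Num.Theory.
Set Implicit Arguments. Unset Strict Implicit. Unset Printing Implicit Defensive.
Local Open Scope ring_scope.

(** Write P = S Q. Monomials of Q are lattice points, and a monomial of P is a simplex
    {m - e_i} of such points, with coefficient the sum of Q over it; indecomposability
    makes the support of Q connected for the relation "vertices of a common simplex".

    Three variables: say a simplex is a "down" triangle p, p - e1, p - e2, as opposed to the
    "up" triangles r, r + e1, r + e2. If W = supp Q, a down triangle whose nonzero vertices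
    all have the same sign contributes a monomial of P. Each lattice edge lies in one down
    and one up triangle, and every triangle inside W has an edge with ends of equal sign, so
    counting such edges in both ways gives
      2 N(P) >= #(down meeting W once) + 2 #(down meeting W) + #(up inside W) - 3 #W.
    The first term is at least 3. The rest does not increase when a vertex completing an up
    triangle is added to W; as W is connected, repeating this fills the smallest triangle
    a >= a0, b >= b0, c >= c0 containing W, of side D = p-degree(P) - 1, for which the value
    is D + 3. Hence 2 N(P) >= D + 6.

    General n: a generic substitution X_i = w_i Y with w_i > 0 for all i other than j, k does not
    increase the number of terms of P and projects W onto the exponents of X_j and X_k. If w
    in W has minimal X_0-exponent, then for suitable j, k <> 0 the reduced exponents of X_j, X_k
    in w add up to at least 1/(n - 1) times the reduced degree of Q. *)

(** * Signs and triangles *)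

Section Triangles.
Variables (T : finZmodType) (e1 e2 : T).
Implicit Types (W V : {set T}) (p q r o : T).

(** Down triangles are indexed by p and up triangles by r. The ambient group is finite, so that
    triangles can be counted and reindexed by translation; [phi] later embeds a bounded part of the
    lattice into it. *)
Definition touched W := [set p | [|| p \in W, p - e1 \in W | p - e2 \in W]].
Definition touched_once W :=
  [set p | ((p \in W) + (p - e1 \in W)%R + (p - e2 \in W)%R == 1)%N].
Definition filled W := [set r | [&& r \in W, r + e1 \in W & r + e2 \in W]].

Lemma sum_shift (F : T -> nat) (v : T) : (\sum_p F (p - v)%R = \sum_p F p)%N.
Proof. by rewrite [RHS](reindex_inj (addIr (- v))). Qed.

Lemma card_sum (A : {set T}) : (#|A| = \sum_p (p \in A))%N.
Proof. by rewrite -sum1_card big_mkcond; apply: eq_bigr => p _; case: (p \in A). Qed.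

Definition supp0 (R : realFieldType) (h : T -> R) := [set q | h q != 0].

Section Signs.
Variables (R : realFieldType) (f g : T -> R) (s0 s1 s2 : R).
Hypotheses (s0_gt0 : 0 < s0) (s1_gt0 : 0 < s1) (s2_gt0 : 0 < s2).
Hypothesis gE : forall p, g p = s0 * f p + s1 * f (p - e1) + s2 * f (p - e2).

Let mono_edge p q : nat := (0 < f p * f q)%R.

(** Let k > 0 vertices be nonzero. If their signs differ, the left side equals k. If they agree,
    [g p] does not vanish and supplies 2, while the left side is 3, 3, 5 for k = 1, 2, 3. *)
Lemma local_sign_count p :
  ((p \in touched_once (supp0 f)) +
    (p \in touched (supp0 f)).*2 +
    (mono_edge p (p - e1)%R + mono_edge p (p - e2)%R + mono_edge (p - e2)%R (p - e1)%R) <=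
   (g p != 0)%R.*2 + ((f p != 0)%R + (f (p - e1)%R != 0)%R + (f (p - e2)%R != 0)%R))%N.
Proof.
rewrite gE !inE /mono_edge.
move: (f p) (f (p - e1)) (f (p - e2)) => x y z.
case: (ltrgt0P x) => hx; case: (ltrgt0P y) => hy; case: (ltrgt0P z) => hz;
  rewrite ?hx ?hy ?hz ?mulr0 ?mul0r ?addr0 ?add0r ?eqxx ?ltxx ?mulf_eq0
     ?(gt_eqF hx) ?(gt_eqF hy) ?(gt_eqF hz) ?(lt_eqF hx) ?(lt_eqF hy) ?(lt_eqF hz)
     ?(gt_eqF s0_gt0) ?(gt_eqF s1_gt0) ?(gt_eqF s2_gt0) //=;
  rewrite ?(pmulr_rgt0 _ hx) ?(pmulr_rgt0 _ hy) ?(pmulr_rgt0 _ hz)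
     ?(nmulr_rgt0 _ hx) ?(nmulr_rgt0 _ hy) ?(nmulr_rgt0 _ hz)
     ?hx ?hy ?hz ?(lt_gtF hx) ?(lt_gtF hy) ?(lt_gtF hz) //=;
  try (by case: (_ == 0));
  try (rewrite gt_eqF //; by rewrite ?addr_gt0 ?mulr_gt0);
  try (rewrite lt_eqF //; by rewrite -oppr_gt0 !opprD -!mulrN ?addr_gt0 ?mulr_gt0 ?oppr_gt0).
Qed.

(** Among three nonzero reals two have the same sign. *)
Lemma mono_edges_filled r :
  ((r \in filled (supp0 f)) <=
   mono_edge (r + e1)%R r + mono_edge (r + e2)%R r + mono_edge (r + e1)%R (r + e2)%R)%N.
Proof.
rewrite !inE /mono_edge.
move: (f r) (f (r + e1)) (f (r + e2)) => x y z.
by case: (ltrgt0P x) => hx; case: (ltrgt0P y) => hy; case: (ltrgt0P z) => hz //=;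
  rewrite ?(pmulr_rgt0 _ hx) ?(pmulr_rgt0 _ hy) ?(pmulr_rgt0 _ hz)
     ?(nmulr_rgt0 _ hx) ?(nmulr_rgt0 _ hy) ?(nmulr_rgt0 _ hz)
     ?hx ?hy ?hz ?(lt_gtF hx) ?(lt_gtF hy) ?(lt_gtF hz) //=.
Qed.

Lemma sign_count :
  (#|touched_once (supp0 f)| + #|touched (supp0 f)|.*2 +
     #|filled (supp0 f)| <=
   #|supp0 g|.*2 + 3 * #|supp0 f|)%N.
Proof.
(* Each edge lies in one down and one up triangle; the translations by e1, e2 and e1 + e2 match the
   two descriptions, one for each edge direction. *)
have edges : (\sum_p (mono_edge p (p - e1)%R + mono_edge p (p - e2)%R +
                mono_edge (p - e2)%R (p - e1)%R) =
    \sum_r (mono_edge (r + e1)%R r + mono_edge (r + e2)%R r +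
                mono_edge (r + e1)%R (r + e2)%R))%N.
  rewrite !big_split /=; congr (_ + _ + _)%N.
  - rewrite -[RHS](sum_shift _ e1); by apply: eq_bigr => p _; rewrite subrK.
  - rewrite -[RHS](sum_shift _ e2); by apply: eq_bigr => p _; rewrite subrK.
  - rewrite -[RHS](sum_shift _ (e1 + e2)); apply: eq_bigr => p _.
    by rewrite opprD addrA subrK (addrAC _ (- e2)) subrK.
set W := supp0 f.
have ks : (\sum_p ((f p != 0)%R + (f (p - e1)%R != 0)%R + (f (p - e2)%R != 0)%R) = 3 * #|W|)%N.
  rewrite !big_split /= (sum_shift (fun p => (f p != 0)%R)) (sum_shift (fun p => (f p != 0)%R)).
  have -> : #|W| = (\sum_p (f p != 0)%R)%N by rewrite card_sum; apply: eq_bigr => p _; rewrite inE.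
  by rewrite !mulSn mul0n addn0 addnA.
rewrite -ks (card_sum (touched_once W)) (card_sum (touched W)) (card_sum (filled W)) card_sum.
rewrite -!muln2 !big_distrl /= -!big_split /=.
apply: (@leq_trans (\sum_p ((p \in touched_once W) + (p \in touched W) * 2) +
   \sum_p (mono_edge p (p - e1)%R + mono_edge p (p - e2)%R + mono_edge (p - e2)%R (p - e1)%R))).
  rewrite edges -big_split /=; apply: leq_sum => p _.
  by rewrite leq_add2l mono_edges_filled.
rewrite -big_split /=; apply: leq_sum => p _.
by have := local_sign_count p; rewrite [p \in supp0 g]inE -!muln2.
Qed.

End Signs.

(** The three down and three up triangles at o alternate around the hexagon of its neighbours. An up
    triangle whose two other vertices are in W makes the two adjacent down triangles already
    touched. If the third one is newly touched, the other two up triangles stay unfilled, for a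
    total of 2 + 1; otherwise at most three up triangles get filled. *)
Lemma fill_step W o : e1 != 0 -> e2 != 0 -> e1 != e2 -> o \notin W ->
    [|| (o + e1 \in W) && (o + e2 \in W),
        (o - e1 \in W) && (o - e1 + e2 \in W) |
        (o - e2 \in W) && (o - e2 + e1 \in W)] ->
  (#|touched (o |: W)|.*2 + #|filled (o |: W)| <=
   #|touched W|.*2 + #|filled W| + 3)%N.
Proof.
move=> e10 e20 e12 oW pair.
have sub1 : touched (o |: W) \subset
    [set p in [set o] | (p - e1 \notin W) && (p - e2 \notin W)] :|:
    ([set p in [set o + e1] | (p \notin W) && (p - e2 \notin W)] :|:
     ([set p in [set o + e2] | (p \notin W) && (p - e1 \notin W)] :|: touched W)).
  apply/subsetP => p; rewrite !inE => h.
  have [->|po] := eqVneq p o.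
    by rewrite (negbTE oW) /=; do 2 case: (_ - _ \in W); rewrite ?orbT.
  have [->|po1] := eqVneq p (o + e1).
    rewrite addrK (negbTE oW) /=; do 2 case: (_ \in W); rewrite ?orbT //.
  have [->|po2] := eqVneq p (o + e2).
    rewrite addrK (negbTE oW) /=; do 2 case: (_ \in W); rewrite ?orbT //.
  by move: h; rewrite (negbTE po) !subr_eq (negbTE po1) (negbTE po2) /= => ->; rewrite ?orbT.
have sub2 : filled (o |: W) \subset
    [set p in [set o] | (p + e1 \in W) && (p + e2 \in W)] :|:
    ([set p in [set o - e1] | (p \in W) && (p + e2 \in W)] :|:
     ([set p in [set o - e2] | (p \in W) && (p + e1 \in W)] :|: filled W)).
  apply/subsetP => p; rewrite !inE => h.
  have E1 (q v : T) : v != 0 -> (q + v == q) = false.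
    by move=> v0; rewrite -subr_eq0 addrAC subrr add0r (negbTE v0).
  have E2 (q v : T) : v != 0 -> (q - v == q) = false.
    by move=> v0; rewrite -subr_eq0 addrAC subrr add0r oppr_eq0 (negbTE v0).
  have [eq_po|po] := eqVneq p o.
    by move: h; rewrite eq_po !E1 // eqxx /= => ->.
  have [eq_po|po1] := eqVneq p (o - e1).
    move: h; rewrite eq_po E2 //= addrNK eqxx /= -addrA.
    rewrite -[X in _ == X]addr0 (inj_eq (addrI _)) addrC subr_eq0 eq_sym (negbTE e12) /=.
    by rewrite addrC -addrA => ->.
  have [eq_po|po2] := eqVneq p (o - e2).
    move: h; rewrite eq_po E2 //= addrNK eqxx /= andbT.
    rewrite -addrA -[X in _ == X]addr0 (inj_eq (addrI _)) addrC subr_eq0 (negbTE e12) /=.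
    by rewrite addrC -addrA => ->.
  move: h; rewrite (negbTE po) /=.
  have -> : (p + e1 == o) = false by apply: contraNF po1 => /eqP <-; rewrite addrK.
  have -> : (p + e2 == o) = false by apply: contraNF po2 => /eqP <-; rewrite addrK.
  by move=> /= ->; rewrite ?orbT.
have bnd (P : pred T) (x : T) (A : {set T}) :
    (#|[set p in [set x] | P p] :|: A| <= P x + #|A|)%N.
  apply: (leq_trans (leq_card_setU _ _)); rewrite leq_add2r.
  case Px: (P x).
    rewrite -[X in (_ <= X)%N](cards1 x); apply: subset_leq_card.
    by apply/subsetP => p; rewrite inE => /andP[].
  rewrite leqn0 cards_eq0; apply/eqP/setP => p; rewrite !inE.
  by apply/negbTE/negP => /andP[/eqP->]; rewrite Px.
have {}sub1 := leq_trans (subset_leq_card sub1) (leq_trans (bnd _ _ _)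
  (leq_add (leqnn _) (leq_trans (bnd _ _ _) (leq_add (leqnn _) (bnd _ _ _))))).
have {}sub2 := leq_trans (subset_leq_card sub2) (leq_trans (bnd _ _ _)
  (leq_add (leqnn _) (leq_trans (bnd _ _ _) (leq_add (leqnn _) (bnd _ _ _))))).
move: sub1 sub2 pair; rewrite /= (addrAC o e1) (addrAC o e2).
move: #|touched _| #|touched _| #|filled _| #|filled _| => a a' b b'.
by rewrite -!addnn; do 6 (case: (_ \in W)); rewrite ?andbT ?andbF /= => h1 h2 h3 //; lia.
Qed.

End Triangles.

(** * Filling a triangle from a connected set *)

Section Spread.
Local Open Scope nat_scope.
Variable D : nat.
Implicit Types v U : nat -> nat -> nat -> bool.

(** No up triangle has exactly two of its vertices in v, so no filling step applies. Points carry
    barycentric coordinates, which makes the three sides of the triangle symmetric. *)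
Definition fill_closed v := forall a b c, (a + b + c).+1 = D ->
  [/\ v a.+1 b c -> v a b.+1 c = v a b c.+1,
      v a b.+1 c -> v a.+1 b c = v a b c.+1 &
      v a b c.+1 -> v a.+1 b c = v a b.+1 c].

(** On the plane a + b + c = D this cuts out a triangle of side D - (a0 + b0 + c0). *)
Definition in_cone (a0 b0 c0 a b c : nat) := [&& a0 <= a, b0 <= b & c0 <= c].

Definition filled_cone v a0 b0 c0 :=
  forall a b c, a + b + c = D -> in_cone a0 b0 c0 a b c -> v a b c.

Lemma fill_closed_swap12 v : fill_closed v -> fill_closed (fun b a c => v a b c).
Proof.
move=> cl a' b' c' s; have [|h1 h2 h3] := cl b' a' c'; first lia.
by split=> // h; symmetry; apply: h3.
Qed.

Lemma fill_closed_swap13 v : fill_closed v -> fill_closed (fun c b a => v a b c).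
Proof.
move=> cl a' b' c' s; have [|h1 h2 h3] := cl c' b' a'; first lia.
by split=> // h; symmetry; auto.
Qed.

(** Two consecutive points of the line a = a0 form an up triangle with a point of the filled row a0
    + 1, so v takes the same value at both. Hence v is constant along the line, and one point of it
    suffices. *)
Lemma filled_cone_grow v a0 b0 c0 b c : fill_closed v ->
  filled_cone v a0.+1 b0 c0 -> a0 + b + c = D -> b0 <= b -> c0 <= c ->
  v a0 b c -> filled_cone v a0 b0 c0.
Proof.
move=> cl full abcD b0b c0c vabc.
have row k : b0 + k + c0 <= D - a0 ->
    v a0 (b0 + k) (D - a0 - b0 - k) = v a0 b0 (D - a0 - b0).
  elim: k => [|k IHk] bd; first by rewrite addn0 subn0.
  rewrite -IHk; last lia.
  have [|h _ _] := cl a0 (b0 + k) (D - a0 - b0 - k.+1); first lia.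
  rewrite addnS h; last by apply: full; rewrite /in_cone; lia.
  by congr (v _ _ _); lia.
have first : v a0 b0 (D - a0 - b0).
  rewrite -(row (b - b0)); last lia.
  have -> : b0 + (b - b0) = b by lia.
  by have -> : D - a0 - b0 - (b - b0) = c by lia.
move=> a' b' c' sumD /and3P[]; rewrite leq_eqVlt => /orP[/eqP ea|lt_a] lb lc.
  rewrite -ea.
  rewrite -(row (b' - b0)) in first; last lia.
  have eb : b0 + (b' - b0) = b' by lia.
  have ec : D - a0 - b0 - (b' - b0) = c' by lia.
  by rewrite eb ec in first.
by apply: full => //; apply/and3P; split.
Qed.

(** For two points with the same coordinate sum, this means equal or adjacent in the lattice. *)
Definition near (a b c a' b' c' : nat) :=
  [|| [&& a <= a'.+1, b <= b' & c <= c'], [&& a <= a', b <= b'.+1 & c <= c']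
    | [&& a <= a', b <= b' & c <= c'.+1]].

Lemma near_cone a0 b0 c0 a b c a' b' c' :
  in_cone a0 b0 c0 a b c -> near a b c a' b' c' -> ~~ in_cone a0 b0 c0 a' b' c' ->
  [\/ [&& a'.+1 == a0, b0 <= b' & c0 <= c'], [&& b'.+1 == b0, a0 <= a' & c0 <= c']
    | [&& c'.+1 == c0, b0 <= b' & a0 <= a']].
Proof.
move=> /and3P[h1 h2 h3] nr out.
suff: [|| [&& a'.+1 == a0, b0 <= b' & c0 <= c'], [&& b'.+1 == b0, a0 <= a' & c0 <= c']
    | [&& c'.+1 == c0, b0 <= b' & a0 <= a']] by case/or3P; [constructor 1|constructor 2|constructor 3].
move: out; rewrite /in_cone; case/or3P: nr => /and3P[h4 h5 h6]; lia.
Qed.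

Definition cone_linked U := forall a0 b0 c0 a b c a' b' c',
  U a b c -> in_cone a0 b0 c0 a b c -> U a' b' c' -> ~~ in_cone a0 b0 c0 a' b' c' ->
  exists x y z x' y' z', [/\ U x y z, in_cone a0 b0 c0 x y z, U x' y' z',
     ~~ in_cone a0 b0 c0 x' y' z' & near x y z x' y' z'].

(** A filled triangle containing a point of U grows by one line at a time: a link of U leaving it
    ends on a line adjacent to one of its sides. The induction is on a0 + b0 + c0, which drops by
    one at each growth. *)
Lemma fill_closed_full v U b1 c1 a2 c2 a3 b3 :
  fill_closed v -> cone_linked U ->
  (forall a b c, U a b c -> v a b c /\ a + b + c = D) ->
  U 0 b1 c1 -> U a2 0 c2 -> U a3 b3 0 -> filled_cone v 0 0 0.
Proof.
move=> cl lk Uv U1 U2 U3.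
suff main k : forall a0 b0 c0 a b c, a0 + b0 + c0 = k -> filled_cone v a0 b0 c0 ->
    U a b c -> in_cone a0 b0 c0 a b c -> filled_cone v 0 0 0.
  have [v1 s1] := Uv _ _ _ U1.
  (* The start is the triangle reduced to the single point (0, b1, c1). *)
  apply: (main (b1 + c1) 0 b1 c1 _ _ _ _ _ U1); rewrite /in_cone ?leqnn //.
  move=> a b c s /and3P[_ h1 h2].
  have -> : a = 0 by lia. have -> : b = b1 by lia. by have -> : c = c1 by lia.
elim: k => [|k IHk] a0 b0 c0 a b c sk full Uabc inc.
  move: sk full => /eqP; rewrite !addn_eq0 => /andP[/andP[/eqP -> /eqP ->] /eqP ->].
  by [].
(* While one of the three bounds is positive, the point of U on the corresponding outer side lies
   outside. *)
have [p [q [r [Up out]]]] : exists p q r, U p q r /\ ~~ in_cone a0 b0 c0 p q r.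
  have [a0p|] := posnP a0; last by exists 0, b1, c1; split=> //; rewrite /in_cone; lia.
  have [b0p|] := posnP b0; last by exists a2, 0, c2; split=> //; rewrite /in_cone; lia.
  by exists a3, b3, 0; split=> //; rewrite /in_cone; lia.
have [x [y [z [x' [y' [z' [U4 i4 U5 o5 nr]]]]]]] := lk _ _ _ _ _ _ _ _ _ Uabc inc Up out.
have [v5 s5] := Uv _ _ _ U5.
have cases := near_cone i4 nr o5.
have weaken a0' b0' c0' : a0' <= a0 -> b0' <= b0 -> c0' <= c0 -> in_cone a0' b0' c0' x y z.
  move=> ha hb hc; case/and3P: i4 => h1 h2 h3.
  by rewrite /in_cone (leq_trans ha) // (leq_trans hb) // (leq_trans hc).
(* [filled_cone_grow] lowers the first bound; the other two are reached by exchanging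
   coordinates. *)
have cl2 := fill_closed_swap12 cl; have cl3 := fill_closed_swap13 cl.
clear nr o5 i4 inc Up out lk Uabc.
case: cases => /and3P[/eqP e h1 h2].
- have full' : filled_cone v x' b0 c0.
    by apply: (filled_cone_grow (b := y') (c := z') cl); rewrite ?e.
  by apply: (IHk _ _ _ _ _ _ _ full' U4); [clear -sk e; lia | rewrite weaken -?e].
- have full' : filled_cone (fun b a c => v a b c) y' a0 c0.
    apply: (filled_cone_grow (b := x') (c := z') cl2); rewrite ?e ?(addnC y') //.
    move=> b'' a'' c'' s' /and3P[g1 g2 g3]; apply: full; last by apply/and3P; split.
    by rewrite (addnC a'').
  have {}full' : filled_cone v a0 y' c0.
    move=> a' b' c' s' /and3P[g1 g2 g3]; apply: full'; last by apply/and3P; split.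
    by rewrite (addnC b').
  by apply: (IHk _ _ _ _ _ _ _ full' U4); [clear -sk e; lia | rewrite weaken -?e].
- have full' : filled_cone (fun c b a => v a b c) z' b0 a0.
    apply: (filled_cone_grow (b := y') (c := x') cl3); rewrite ?e //; last by clear -s5; lia.
    move=> c'' b'' a'' s' /and3P[g1 g2 g3]; apply: full; last by apply/and3P; split.
    by clear -s'; lia.
  have {}full' : filled_cone v a0 b0 z'.
    move=> a' b' c' s' /and3P[g1 g2 g3]; apply: full'; last by apply/and3P; split.
    by clear -s'; lia.
  by apply: (IHk _ _ _ _ _ _ _ full' U4); [clear -sk e; lia | rewrite weaken -?e].
Qed.

End Spread.

(** * Counting triangles in an embedded lattice *)

Section Embedding.
Variables (T : finZmodType) (e1 e2 : T) (D : nat).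

(** The third barycentric coordinate D - a - b is left implicit. Injectivity up to D + 2 rules out
    wrap-around on [triangle D] and on the triangles that meet it. *)
Definition phi (a b : nat) : T := e1 *+ a + e2 *+ b.

Hypothesis phi_inj : forall a b c d, (a <= D.+2)%N -> (b <= D.+2)%N -> (c <= D.+2)%N ->
  (d <= D.+2)%N -> phi a b = phi c d -> a = c /\ b = d.

Lemma phiD a b c d : phi a b + phi c d = phi (a + c) (b + d).
Proof. by rewrite /phi !mulrnDr addrACA. Qed.

Lemma phi_e1 a b : phi a b + e1 = phi a.+1 b.
Proof. by rewrite /phi mulrSr addrAC. Qed.

Lemma phi_e2 a b : phi a b + e2 = phi a b.+1.
Proof. by rewrite /phi mulrSr addrA. Qed.

Definition triangle (s : nat) : {set T} :=
  [set phi p.1 p.2 | p : 'I_s.+1 * 'I_s.+1 & (p.1 + p.2 <= s)%N].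

Lemma phi_triangle s a b : (a + b <= s)%N -> phi a b \in triangle s.
Proof.
move=> h; have ha : (a < s.+1)%N by lia.
have hb : (b < s.+1)%N by lia.
by apply/imsetP; exists (Ordinal ha, Ordinal hb); rewrite ?inE.
Qed.

Lemma triangleP s x : x \in triangle s -> exists a b, x = phi a b /\ (a + b <= s)%N.
Proof. by case/imsetP => p; rewrite inE => h ->; exists p.1, p.2. Qed.

Lemma mem_triangle s a b : (s <= D.+2)%N -> (a <= D.+2)%N -> (b <= D.+2)%N ->
  (phi a b \in triangle s) = (a + b <= s)%N.
Proof.
move=> hs ha hb; apply/idP/idP; last exact: phi_triangle.
by case/triangleP => a' [b' [/phi_inj eab h]]; have [] := eab; lia.
Qed.

Lemma card_triangle s : (s <= D.+2)%N -> (#|triangle s|.*2 = s.+1 * s.+2)%N.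
Proof.
move=> hs; rewrite card_in_imset; last first.
  move=> [[a ha] [b hb]] [[c hc] [d hd]] _ _ /= /phi_inj [] //=; try lia.
  by move=> eac ebd; congr (_, _); apply: val_inj.
have count_lt k m : (\sum_(j < m) (j < k) = minn k m)%N.
  elim: m => [|m IHm]; first by rewrite big_ord0 minn0.
  by rewrite big_ord_recr /= IHm; lia.
rewrite -sum1_card (eq_bigl (fun p : 'I_s.+1 * 'I_s.+1 => true && (p.1 + p.2 <= s)%N)).
  rewrite -(pair_big_dep xpredT (fun i j : 'I_s.+1 => i + j <= s)%N (fun _ _ => 1%N)) /=.
  rewrite (eq_bigr (fun i : 'I_s.+1 => s.+1 - i)%N); last first.
    move=> i _; rewrite big_mkcond /= -(_ : minn (s.+1 - i) s.+1 = s.+1 - i)%N; last lia.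
    by rewrite -count_lt; apply: eq_bigr => j _; rewrite ltn_subRL ltnS; case: leqP.
  elim: (s.+1) => [|m IHm]; first by rewrite big_ord0.
  rewrite big_ord_recl /= (eq_bigr (fun i : 'I_m => m - i)%N); last by move=> i _; rewrite subSS.
  by rewrite doubleD IHm subn0; lia.
by move=> p; rewrite inE.
Qed.

Lemma e1_neq0 : e1 != 0.
Proof.
apply/eqP => e; have [] := @phi_inj 1 0 0 0 => //.
by rewrite /phi e mulr0n mul0rn.
Qed.

Lemma e2_neq0 : e2 != 0.
Proof.
apply/eqP => e; have [] := @phi_inj 0 1 0 0 => //.
by rewrite /phi e mulr0n mul0rn.
Qed.

Lemma e1_neq_e2 : e1 != e2.
Proof.
apply/eqP => e; have [] := @phi_inj 1 0 0 1 => //.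
by rewrite /phi e !mulr0n addr0 add0r.
Qed.

Section Support.
Variable W : {set T}.

Definition unit_steps : seq (nat * nat) := [:: (0, 0); (1, 0); (0, 1)]%N.

(* u and v are vertices of a common triangle p, p - e1, p - e2. *)
Definition linked_set := forall X : pred T,
  (exists2 u, u \in W & X u) -> (exists2 u, u \in W & ~~ X u) ->
  exists u v i j, [/\ u \in W, X u, v \in W, ~~ X v &
    [/\ i \in unit_steps, j \in unit_steps & u + phi i.1 i.2 = v + phi j.1 j.2]].

Hypotheses (subW : W \subset triangle D) (linkedW : linked_set).
Hypothesis touch1 : exists2 b, (b <= D)%N & phi 0 b \in W.
Hypothesis touch2 : exists2 a, (a <= D)%N & phi a 0 \in W.
Hypothesis touch3 : exists2 a, (a <= D)%N & phi a (D - a) \in W.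

Let U a b c := (a + b + c == D)%N && (phi a b \in W).

Lemma near_steps (a b a' b' : nat) i j : i \in unit_steps -> j \in unit_steps ->
   (a + b <= D)%N -> (a' + b' <= D)%N -> (a + i.1 = a' + j.1)%N -> (b + i.2 = b' + j.2)%N ->
   near a b (D - a - b) a' b' (D - a' - b').
Proof.
by rewrite !inE => /or3P[] /eqP -> /or3P[] /eqP -> /= *; rewrite /near; lia.
Qed.

Lemma cone_linked_support : cone_linked U.
Proof.
move=> a0 b0 c0 a b c a' b' c' /andP[/eqP s u] i /andP[/eqP s' u'] o.
(* [linked_set] cuts by predicates on T, so the cone is transported there as an image; [phi_inj]
   lets its coordinates be read back. *)
pose A := [set phi q.1 q.2 | q : 'I_D.+1 * 'I_D.+1
   & (q.1 + q.2 <= D)%N && in_cone a0 b0 c0 q.1 q.2 (D - q.1 - q.2)].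
pose X x := x \in A.
have XE p q : (p + q <= D)%N -> X (phi p q) = in_cone a0 b0 c0 p q (D - p - q).
  move=> pq; rewrite /X; apply/imsetP/idP => [[[[x hx] [y hy]] h]|h].
    move: h; rewrite inE /= => /andP[h1 h2] /phi_inj epq.
    by have [||||-> ->] := epq; try lia.
  have hp : (p < D.+1)%N by lia.
  have hq : (q < D.+1)%N by lia.
  by exists (Ordinal hp, Ordinal hq); rewrite ?inE /= ?pq.
have e : (D - a - b)%N = c by lia.
have e' : (D - a' - b')%N = c' by lia.
have [||x [y [k [l [xW xX yW yX [kS lS xy]]]]]] := linkedW (X := X).
- by exists (phi a b); rewrite // XE ?e //; lia.
- by exists (phi a' b'); rewrite // XE ?e' //; lia.
have [p [q [ex pq]]] := triangleP (subsetP subW _ xW).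
have [p' [q' [ey pq']]] := triangleP (subsetP subW _ yW).
rewrite {}ex {}ey in xW xX yW yX xy.
have bd m : m \in unit_steps -> (m.1 <= 1)%N /\ (m.2 <= 1)%N.
  by rewrite !inE => /or3P[] /eqP ->.
have [k1 k2] := bd _ kS; have [l1 l2] := bd _ lS.
move: xy; rewrite !phiD => /phi_inj [| | | |h1 h2]; try (clear -k1 k2 l1 l2 pq pq'; lia).
exists p, q, (D - p - q)%N, p', q', (D - p' - q')%N; split.
- by rewrite /U xW andbT; apply/eqP; clear -pq; lia.
- by rewrite -XE.
- by rewrite /U yW andbT; apply/eqP; clear -pq'; lia.
- by rewrite -XE.
- exact: near_steps h1 h2.
Qed.

(** The touched triangles include [triangle D.+1] and, for D > 0, the filled ones include
    [triangle D.-1]. The bound is then (D+2)(D+3) + D(D+1)/2 - 3(D+1)(D+2)/2 = D + 3. *)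
Lemma triangle_count :
  (3 * #|triangle D| + D + 3 <= #|touched e1 e2 (triangle D)|.*2 + #|filled e1 e2 (triangle D)|)%N.
Proof.
have t : triangle D.+1 \subset touched e1 e2 (triangle D).
  apply/subsetP => x /triangleP[a [b [-> h]]]; rewrite inE.
  case: a h => [|a] h.
    case: b h => [|b] h; first by rewrite phi_triangle.
    by rewrite -phi_e2 addrK (phi_triangle (s := D)) ?orbT //; lia.
  by rewrite -phi_e1 addrK (phi_triangle (s := D)) ?orbT //; lia.
have f : (D * D.+1 <= #|filled e1 e2 (triangle D)|.*2)%N.
  have [D0|D0] := posnP D; first by rewrite {1}D0 mul0n.
  have fs : triangle D.-1 \subset filled e1 e2 (triangle D).
    apply/subsetP => x /triangleP[a [b [-> h]]].
    by rewrite inE phi_e1 phi_e2 !phi_triangle //; lia.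
  have := subset_leq_card fs; rewrite -leq_double card_triangle ?prednK //; lia.
have := subset_leq_card t; rewrite -leq_double card_triangle // => h.
have e := card_triangle (leq_trans (leqnSn D) (leqnSn D.+1)).
rewrite -!addnn in e h f *; nia.
Qed.

(** Induction on the number of missing points. Adding a point raises the left side by 3 and the
    right side by at most 3, so the bound descends from the larger set to V. When no point can be
    added, V is [fill_closed], hence the whole triangle. *)
Lemma fill_bound (V : {set T}) : W \subset V -> V \subset triangle D ->
  (3 * #|V| + D + 3 <= #|touched e1 e2 V|.*2 + #|filled e1 e2 V|)%N.
Proof.
have [k] := ubnP #|triangle D :\: V|; elim: k V => // k IHk V hk WV VT.
pose pair o := [|| (o + e1 \in V) && (o + e2 \in V),
        (o - e1 \in V) && (o - e1 + e2 \in V) |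
        (o - e2 \in V) && (o - e2 + e1 \in V)].
case: (pickP [pred o | [&& o \in triangle D, o \notin V & pair o]]) => [o /and3P[oT oV op]|none].
  have := fill_step e1_neq0 e2_neq0 e1_neq_e2 oV op.
  have := IHk (o |: V); rewrite cardsU1 oV => IH st.
  have {}IH : (3 * (true + #|V|) + D + 3 <=
      #|touched e1 e2 (o |: V)|.*2 + #|filled e1 e2 (o |: V)|)%N.
    apply: IH.
    - rewrite -ltnS; apply: leq_trans hk; rewrite ltnS; apply: proper_card; apply/properP; split.
        by apply: setDS; apply: subsetUr.
      by exists o; rewrite !inE ?eqxx ?oV.
    - exact: subset_trans WV (subsetUr _ _).
    - by rewrite subUset sub1set oT.
  by lia.
have closed o : o \in triangle D -> pair o -> o \in V.
  by move=> oT op; have := none o; rewrite /= oT op andbT; case: (o \in V).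
pose v (a b c : nat) := phi a b \in V.
have vcl : fill_closed D v.
  move=> a b c s; rewrite /v -phi_e1 -phi_e2.
  have t0 : phi a b \in triangle D by apply: phi_triangle; lia.
  have t1 : phi a b + e1 \in triangle D by rewrite phi_e1; apply: phi_triangle; lia.
  have t2 : phi a b + e2 \in triangle D by rewrite phi_e2; apply: phi_triangle; lia.
  have := closed _ t0; have := closed _ t1; have := closed _ t2.
  rewrite /pair !addrK; move: (phi a b) => r.
  case: (r \in V); case: (r + e1 \in V); case: (r + e2 \in V) => /=;
    rewrite ?orbT => h2 h1 h0; split=> //;
    by [have := h0 isT | have := h1 isT | have := h2 isT].
have [b1 h1 U1] := touch1; have [a2 h2 U2] := touch2; have [a3 h3 U3] := touch3.
have full : filled_cone D v 0 0 0.
  apply: (fill_closed_full (U := U) (b1 := b1) (c1 := D - b1) (a2 := a2) (c2 := D - a2)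
            (a3 := a3) (b3 := D - a3) vcl cone_linked_support).
  - by move=> a b c /andP[/eqP -> /(subsetP WV)].
  - by rewrite /U U1 andbT; apply/eqP; lia.
  - by rewrite /U U2 andbT; apply/eqP; lia.
  - by rewrite /U U3 andbT; apply/eqP; lia.
have -> : V = triangle D.
  apply/eqP; rewrite eqEsubset VT; apply/subsetP => x /triangleP[a [b [-> h]]].
  by apply: (full a b (D - a - b)%N) => //; lia.
exact: triangle_count.
Qed.
Lemma extreme_point (h : nat -> nat -> nat) (B : nat) :
  (forall a b, (a + b <= D)%N -> (h a b <= B)%N) ->
  exists a b, [/\ (a + b <= D)%N, phi a b \in W &
    forall x y, (x + y <= D)%N -> phi x y \in W -> (h x y <= h a b)%N].
Proof.
move=> hB.
pose Q k := [exists q : 'I_D.+1 * 'I_D.+1,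
  [&& (q.1 + q.2 <= D)%N, phi q.1 q.2 \in W & h q.1 q.2 == k]].
have QP a b : (a + b <= D)%N -> phi a b \in W -> Q (h a b).
  move=> ab abW; have ha : (a < D.+1)%N by lia.
  have hb : (b < D.+1)%N by lia.
  by apply/existsP; exists (Ordinal ha, Ordinal hb); rewrite /= ab abW eqxx.
have exQ : exists k, Q k.
  by have [b hb bW] := touch1; exists (h 0 b); apply: QP.
have ubQ k : Q k -> (k <= B)%N.
  by case/existsP => q /and3P[q1 _ /eqP <-]; apply: hB.
case: (ex_maxnP exQ ubQ) => k /existsP[q /and3P[q1 q2 /eqP <-]] kmax.
by exists q.1, q.2; split=> // x y xy /(QP _ _ xy) /kmax.
Qed.

Lemma phi_mem a b : (a <= D.+2)%N -> (b <= D.+2)%N -> phi a b \in W -> (a + b <= D)%N.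
Proof. by move=> ha hb /(subsetP subW); rewrite mem_triangle //; lia. Qed.

Lemma phi_sub1_mem a b : (a <= D.+2)%N -> (b <= D.+2)%N -> phi a b - e1 \in W ->
  exists x, [/\ a = x.+1, (x + b <= D)%N & phi x b \in W].
Proof.
move=> ha hb h; have [x [y [e xy]]] := triangleP (subsetP subW _ h).
rewrite e in h; move/eqP: e; rewrite subr_eq phi_e1 => /eqP /phi_inj e.
by have [||||ea eb] := e; [lia..|exists x; rewrite eb; split].
Qed.

Lemma phi_sub2_mem a b : (a <= D.+2)%N -> (b <= D.+2)%N -> phi a b - e2 \in W ->
  exists y, [/\ b = y.+1, (a + y <= D)%N & phi a y \in W].
Proof.
move=> ha hb h; have [x [y [e xy]]] := triangleP (subsetP subW _ h).
rewrite e in h; move/eqP: e; rewrite subr_eq phi_e2 => /eqP /phi_inj e.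
by have [||||ea eb] := e; [lia..|exists y; rewrite ea; split].
Qed.

(* The triangles just beyond a vertex of W maximal in each of the three directions
   meet W in that vertex only. *)
Lemma touched_once_ge3 : (3 <= #|touched_once e1 e2 W|)%N.
Proof.
have [a1 [b1 [s1 W1 m1]]] := @extreme_point (fun a b => a) D ltac:(move=> *; lia).
have [a2 [b2 [s2 W2 m2]]] := @extreme_point (fun a b => b) D ltac:(move=> *; lia).
have [a3 [b3 [s3 W3 m3]]] := @extreme_point (fun a b => D - (a + b))%N D ltac:(move=> *; lia).
have o1 : phi a1.+1 b1 \in touched_once e1 e2 W.
  rewrite inE -{2}phi_e1 addrK W1.
  have -> : (phi a1.+1 b1 \in W) = false.
    apply/negP => h; have h' : (a1.+1 + b1 <= D)%N by apply: phi_mem h; lia.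
    by have /= := m1 _ _ h' h; rewrite ltnn.
  suff -> : (phi a1.+1 b1 - e2 \in W) = false by [].
  apply/negP => /phi_sub2_mem[||y [_ sy hy]]; try lia.
  by have /= := m1 _ _ sy hy; rewrite ltnn.
have o2 : phi a2 b2.+1 \in touched_once e1 e2 W.
  rewrite inE -{3}phi_e2 addrK W2.
  have -> : (phi a2 b2.+1 \in W) = false.
    apply/negP => h; have h' : (a2 + b2.+1 <= D)%N by apply: phi_mem h; lia.
    by have /= := m2 _ _ h' h; rewrite ltnn.
  suff -> : (phi a2 b2.+1 - e1 \in W) = false by [].
  apply/negP => /phi_sub1_mem[||y [_ sy hy]]; try lia.
  by have /= := m2 _ _ sy hy; rewrite ltnn.
have o3 : phi a3 b3 \in touched_once e1 e2 W.
  rewrite inE W3.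
  have -> : (phi a3 b3 - e1 \in W) = false.
    apply/negP => /phi_sub1_mem[||y [ey sy hy]]; try lia.
    by have /= := m3 _ _ sy hy; lia.
  suff -> : (phi a3 b3 - e2 \in W) = false by [].
  apply/negP => /phi_sub2_mem[||y [ey sy hy]]; try lia.
  by have /= := m3 _ _ sy hy; lia.
have d12 : phi a1.+1 b1 != phi a2 b2.+1.
  apply/eqP => /phi_inj e; have [||||ea eb] := e; try lia.
  by have /= := m2 _ _ s1 W1; rewrite eb ltnn.
have d13 : phi a1.+1 b1 != phi a3 b3.
  apply/eqP => /phi_inj e; have [||||ea eb] := e; try lia.
  by have /= := m1 _ _ s3 W3; rewrite -ea ltnn.
have d23 : phi a2 b2.+1 != phi a3 b3.
  apply/eqP => /phi_inj e; have [||||ea eb] := e; try lia.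
  by have /= := m2 _ _ s3 W3; rewrite -eb ltnn.
have <- : #|[set phi a1.+1 b1; phi a2 b2.+1; phi a3 b3]| = 3%N.
  by rewrite -setUA cardsU1 cards2 !inE negb_or d12 d13 d23.
by apply: subset_leq_card; rewrite !subUset !sub1set o1 o2 o3.
Qed.

End Support.

(** The three-variable case: g holds the coefficients of (s0 X_0 + s1 X_1 + s2 X_2) Q, where f holds
    those of Q. The positive weights are what merging several variables produces. *)
Lemma sparse_support_bound (R : realFieldType) (f g : T -> R) (s0 s1 s2 : R) :
  0 < s0 -> 0 < s1 -> 0 < s2 ->
  (forall p, g p = s0 * f p + s1 * f (p - e1) + s2 * f (p - e2)) ->
  supp0 f \subset triangle D -> linked_set (supp0 f) ->
  (exists2 b, (b <= D)%N & phi 0 b \in supp0 f) ->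
  (exists2 a, (a <= D)%N & phi a 0 \in supp0 f) ->
  (exists2 a, (a <= D)%N & phi a (D - a) \in supp0 f) ->
  (D + 6 <= #|supp0 g|.*2)%N.
Proof.
move=> s0p s1p s2p gE sub lk t1 t2 t3.
have c := sign_count s0p s1p s2p gE.
have o := touched_once_ge3 sub t1.
have b := fill_bound sub lk t1 t2 t3 (subxx _) sub.
by rewrite -!addnn in c b *; lia.
Qed.

End Embedding.

(** * Multiplication and division by S *)

Lemma eq_big_support (I : eqType) (V : nmodType) (s1 s2 : seq I) (F : I -> V) :
  uniq s1 -> uniq s2 -> (forall x, F x != 0 -> (x \in s1) = (x \in s2)) ->
  \sum_(x <- s1) F x = \sum_(x <- s2) F x.
Proof.
move=> u1 u2 h.
have nz s : \sum_(x <- s) F x = \sum_(x <- [seq x <- s | F x != 0]) F x.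
  rewrite big_filter [RHS]big_mkcond; apply: eq_bigr => x _.
  by case: eqVneq.
rewrite nz [RHS]nz; apply: perm_big; apply: uniq_perm; rewrite ?filter_uniq // => x.
by rewrite !mem_filter; case: (boolP (F x != 0)) => // /h ->.
Qed.

Lemma base_expansion_inj K n (f g : 'I_n -> nat) :
  (forall i, f i < K)%N -> (forall i, g i < K)%N ->
  (\sum_(i < n) f i * K ^ i = \sum_(i < n) g i * K ^ i)%N -> f =1 g.
Proof.
elim: n f g => [|n IHn] f g fK gK; first by move=> _ [].
rewrite !big_ord_recl !expn0 !muln1.
have K0 : (0 < K)%N by apply: leq_ltn_trans (fK ord0).
have tl (h : 'I_n.+1 -> nat) : (\sum_(i < n) h (lift ord0 i) * K ^ lift ord0 i =
    (\sum_(i < n) h (lift ord0 i) * K ^ i) * K)%N.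
  by rewrite big_distrl /=; apply: eq_bigr => i _; rewrite /bump leq0n add1n expnSr mulnA.
rewrite !tl => e.
have e0 : f ord0 = g ord0.
  by have := congr1 (modn^~ K) e; rewrite /= !(addnC (_ ord0)) !modnMDl !modn_small.
move: e; rewrite e0 => /addnI /eqP; rewrite eqn_pmul2r // => /eqP /IHn e' i.
by case: (unliftP ord0 i) => [j ->|-> //]; apply: e'.
Qed.

(** A nonzero p has fewer roots than [size p], so one of the integers 1, ..., [size p] is not a
    root. *)
Lemma poly_pos_nonroot (R : realFieldType) (p : {poly R}) :
  p != 0 -> exists2 t, 0 < t & p.[t] != 0.
Proof.
move=> p0; pose s := [seq (i.+1)%:R : R | i <- iota 0 (size p)].
have [/allP sroot|/allPn[t]] := boolP (all (root p) s).
  have us : uniq s by rewrite map_inj_uniq ?iota_uniq // => i j /eqP; rewrite eqr_nat => /eqP[].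
  have := max_poly_roots p0 (introT allP sroot) us.
  by rewrite size_map size_iota ltnn.
by case/mapP => i _ -> nr; exists (i.+1%:R); rewrite ?ltr0n.
Qed.

Section Monomials.
Variable n : nat.
Implicit Types (m : mono n) (i : 'I_n.+1).

Definition addU m i : mono n := [ffun j => (m j + (j == i))%N].
Definition subU m i : mono n := [ffun j => (m j - (j == i))%N].

Lemma addUK m i : subU (addU m i) i = m.
Proof. by apply/ffunP => j; rewrite !ffunE addnK. Qed.

Lemma subUK m i : (0 < m i)%N -> addU (subU m i) i = m.
Proof.
by move=> h; apply/ffunP => j; rewrite !ffunE; case: eqVneq => [->|_]; rewrite ?subnK // subn0 addn0.
Qed.

Lemma addU_inj i : injective (addU^~ i).
Proof. by apply: (can_inj (g := subU^~ i)) => m; apply: addUK. Qed.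

Lemma addU_gt0 m i : (0 < addU m i i)%N.
Proof. by rewrite ffunE eqxx addn1. Qed.

Lemma mdeg_addU m i : mdeg (addU m i) = (mdeg m).+1.
Proof.
rewrite /mdeg (eq_bigr (fun j => m j + (j == i))%N) => [|j _]; last by rewrite ffunE.
rewrite big_split /= -[RHS]addn1; congr addn.
by rewrite (bigD1 i) //= eqxx big1 // => j /negbTE ->.
Qed.

Lemma mdeg_subU m i : (0 < m i)%N -> (mdeg (subU m i)).+1 = mdeg m.
Proof. by move=> /subUK {2}<-; rewrite mdeg_addU. Qed.

Lemma leq_mdeg m i : (m i <= mdeg m)%N.
Proof. by rewrite /mdeg (bigD1 i) //= leq_addr. Qed.

Definition monos (L : nat) : seq (mono n) :=
  [seq [ffun i => nat_of_ord (f i)] | f : {ffun 'I_n.+1 -> 'I_L.+1} <- enum {: {ffun 'I_n.+1 -> 'I_L.+1}}].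

Lemma monos_uniq L : uniq (monos L).
Proof.
rewrite map_inj_uniq ?enum_uniq // => f g /ffunP e; apply/ffunP => i.
by have := e i; rewrite !ffunE => /val_inj.
Qed.

Lemma mem_monos L m : (m \in monos L) = [forall i, m i <= L]%N.
Proof.
apply/mapP/forallP => [[f _ ->] i|h]; first by rewrite ffunE -ltnS.
exists [ffun i => inord (m i)]; first by rewrite mem_enum.
by apply/ffunP => i; rewrite !ffunE inordK // ltnS.
Qed.

Lemma mem_monos_mdeg m : m \in monos (mdeg m).
Proof. by rewrite mem_monos; apply/forallP => i; apply: leq_mdeg. Qed.

(** The power of t that m becomes under the Kronecker substitution X_i = t^(K^i). *)
Definition code K m : nat := (\sum_(i < n.+1) m i * K ^ i)%N.

Lemma code_inj L : {in monos L &, injective (code L.+1)}.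
Proof.
move=> m m'; rewrite !mem_monos => /forallP h /forallP h' /base_expansion_inj e.
by apply/ffunP => i; apply: e => j; rewrite ltnS.
Qed.

Lemma code_addU K m i : code K (addU m i) = (code K m + K ^ i)%N.
Proof.
rewrite /code (eq_bigr (fun j : 'I_n.+1 => m j * K ^ j + (j == i) * K ^ j)%N) => [|j _]; last first.
  by rewrite ffunE mulnDl.
rewrite big_split /=; congr addn; rewrite (bigD1 i) //= eqxx mul1n big1 ?addn0 // => j /negbTE ->.
by rewrite mul0n.
Qed.

Section Coefficients.
Variable R : realFieldType.
Implicit Types (q f : mono n -> R).

Definition homog d q := forall m, q m != 0 -> mdeg m = d.

Lemma homog_mem d q L m : homog d q -> (d <= L)%N -> q m != 0 -> m \in monos L.
Proof.
move=> hq dL /hq e; rewrite mem_monos; apply/forallP => i.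
by apply: leq_trans dL; rewrite -e leq_mdeg.
Qed.

Definition kronecker (s : seq (mono n)) K q : {poly R} := \sum_(m <- s) q m *: 'X^(code K m).

Lemma kronecker_horner s K q t :
  (kronecker s K q).[t] = \sum_(m <- s) q m * t ^+ code K m.
Proof. by rewrite horner_sum; apply: eq_bigr => m _; rewrite hornerZ hornerXn. Qed.

Lemma kronecker_coef L q m : m \in monos L ->
  (kronecker (monos L) L.+1 q)`_(code L.+1 m) = q m.
Proof.
move=> hm; rewrite coef_sum (bigD1_seq m) ?monos_uniq //= coefZ coefXn eqxx mulr1.
rewrite big1_seq ?addr0 // => m' /andP[ne hm'].
rewrite coefZ coefXn; case: eqP => [/code_inj e|_]; last by rewrite mulr0.
by rewrite e ?eqxx // in ne.
Qed.

Definition mulS q m : R := \sum_(i | (0 < m i)%N) q (subU m i).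

Lemma mulS_homog d q : homog d q -> homog d.+1 (mulS q).
Proof.
move=> hq m; apply: contraNeq => ne; apply/eqP; apply: big1 => i mi.
by apply/eqP; apply: contraNT ne => /hq <-; rewrite mdeg_subU.
Qed.

(** The adjoint of multiplication by S. It serves twice: with F the value of a monomial at a point,
    and with F a weight supported on a fiber of a projection. *)
Lemma sum_mulS d q (F : mono n -> R) : homog d q ->
  \sum_(m <- monos d.+1) mulS q m * F m =
  \sum_(m <- monos d) q m * \sum_i F (addU m i).
Proof.
move=> hq.
under eq_bigr do rewrite big_distrl /= big_mkcond.
under [RHS]eq_bigr do rewrite big_distrr /=.
rewrite exchange_big [RHS]exchange_big /=; apply: eq_bigr => i _.
pose G m := if (0 < m i)%N then q (subU m i) * F m else 0.
rewrite [RHS](eq_bigr (fun m => G (addU m i))) => [|m _]; last by rewrite /G addU_gt0 addUK.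
rewrite -(big_map (addU^~ i) xpredT G); apply: eq_big_support.
- exact: monos_uniq.
- by rewrite map_inj_uniq ?monos_uniq //; apply: addU_inj.
move=> m; case: ifP => mi; last by rewrite eqxx.
move=> nz; have qm : q (subU m i) != 0 by apply: contraNneq nz => ->; rewrite mul0r.
have -> : m \in monos d.+1.
  by have := mem_monos_mdeg m; rewrite -(mdeg_subU mi) (hq _ qm).
by apply/esym/mapP; exists (subU m i); rewrite ?subUK // (homog_mem hq).
Qed.

Definition mpoly_of d q (hq : homog d q) : mpoly R n :=
  MPoly (fun m => homog_mem hq (leqnn d)).

Lemma evalE d (P : mpoly R n) x : homog d (coef P) ->
  eval P x = \sum_(m <- monos d) coef P m * \prod_(i < n.+1) x i ^+ m i.
Proof.
move=> hP; apply: eq_big_support; rewrite ?monos_uniq ?undup_uniq // => m nz.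
have Pm : coef P m != 0 by apply: contraNneq nz => ->; rewrite mul0r.
by rewrite mem_undup mem_filter Pm (homog_mem hP) // supp_ok.
Qed.

Lemma prod_addU (x : 'I_n.+1 -> R) m i :
  \prod_(j < n.+1) x j ^+ addU m i j = (\prod_(j < n.+1) x j ^+ m j) * x i.
Proof.
under eq_bigr do rewrite ffunE exprD.
rewrite big_split /=; congr (_ * _).
by rewrite (bigD1 i) //= eqxx expr1 big1 ?mulr1 // => j /negbTE ->; rewrite expr0.
Qed.

Lemma sum_mulS_eval d q x : homog d q ->
  \sum_(m <- monos d.+1) mulS q m * \prod_(i < n.+1) x i ^+ m i =
  (\sum_(m <- monos d) q m * \prod_(i < n.+1) x i ^+ m i) * S x.
Proof.
move=> hq; rewrite (sum_mulS _ hq) big_distrl /=; apply: eq_bigr => m _.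
rewrite -mulrA; congr (_ * _); rewrite /S big_distrr /=.
by apply: eq_bigr => i _; rewrite prod_addU.
Qed.

Lemma mulS_inI d q (hq : homog d q) : inI (mpoly_of (mulS_homog hq)).
Proof.
split=> [|x Sx]; first by exists d.+1; apply: mulS_homog.
rewrite (@evalE d.+1) //=; last exact: mulS_homog.
by rewrite sum_mulS_eval // Sx mulr0.
Qed.

(** Let m1 have maximal X_0-exponent in the support of q. Nothing cancels at m1 X_0: another
    contribution would come from a monomial of q with X_0-exponent one larger. *)
Lemma mulS_neq0 d q m : homog d q -> q m != 0 -> exists m', mulS q m' != 0.
Proof.
move=> hq qm.
pose Q k := has (fun m => (q m != 0) && (m ord0 == k)) (monos d).
have exQ : exists k, Q k.
  by exists (m ord0); apply/hasP; exists m; [apply: (homog_mem hq) | rewrite qm eqxx].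
have ubQ k : Q k -> (k <= d)%N.
  by case/hasP => m' _ /andP[/hq <- /eqP <-]; apply: leq_mdeg.
case: (ex_maxnP exQ ubQ) => k /hasP[m1 _ /andP[q1 /eqP e1]] kmax.
exists (addU m1 ord0); rewrite /mulS (bigD1 ord0) ?addU_gt0 //= addUK big1 ?addr0 //.
move=> i /andP[_ i0]; apply/eqP/negPn/negP => nz.
have /kmax : Q k.+1.
  apply/hasP; exists (subU (addU m1 ord0) i); first exact: (homog_mem hq).
  by rewrite nz /= !ffunE eqxx [ord0 == i]eq_sym (negbTE i0) subn0 addn1 e1.
by rewrite ltnn.
Qed.

Section Quotient.
Variables (d : nat) (f : mono n -> R).
Hypothesis f_homog : homog d f.

(* f = S q determines q by descending induction on the exponent of X_0; the fuel k
   bounds the degree of m in the other variables. *)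
Fixpoint quo_rec (k : nat) m : R :=
  if k is k'.+1 then
    f (addU m ord0) - \sum_(i | (i != ord0) && (0 < m i)%N) quo_rec k' (subU (addU m ord0) i)
  else 0.

Definition tail_deg m : nat := (\sum_(i < n.+1 | i != ord0) m i)%N.

Definition quo m : R := quo_rec (tail_deg m).+1 m.

(** Passing from m to m X_0 / X_i with i <> 0 lowers [tail_deg] by exactly one, so the remaining
    fuel is again the one prescribed by [quo]. *)
Lemma quoE m : quo m =
  f (addU m ord0) - \sum_(i | (i != ord0) && (0 < m i)%N) quo (subU (addU m ord0) i).
Proof.
rewrite {1}/quo /=; congr (_ - _); apply: eq_bigr => i /andP[i0 mi].
rewrite /quo; congr quo_rec; rewrite /tail_deg (bigD1 i) //= [in RHS](bigD1 i) //=.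
rewrite !ffunE eqxx (negbTE i0) addn0 -addSn subn1 prednK //; congr addn.
apply: eq_bigr => j /andP[j0 ji]; by rewrite !ffunE (negbTE j0) (negbTE ji) addn0 subn0.
Qed.

Lemma quo_rec_mdeg k m : quo_rec k m != 0 -> (mdeg m).+1 = d.
Proof.
elim: k m => [|k IHk] m /=; first by rewrite eqxx.
apply: contraNeq => ne; rewrite big1 ?subr0.
  by apply: contraNT ne => /f_homog <-; rewrite mdeg_addU.
move=> i /andP[i0 mi]; apply/eqP; apply: contraNT ne => /IHk <-.
by rewrite mdeg_subU ?mdeg_addU // ffunE (leq_trans mi) ?leq_addr.
Qed.

Lemma quo_homog : homog d.-1 quo.
Proof. by move=> m /quo_rec_mdeg <-. Qed.

Lemma mulS_quo m : (0 < m ord0)%N -> mulS quo m = f m.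
Proof.
move=> m0; rewrite /mulS (bigD1 ord0) //= quoE subUK // -[RHS](subrK (\sum_(i | (0 < m i)%N && (i != ord0)) quo (subU m i))).
congr (_ - _ + _); apply: eq_big => [i|//].
by rewrite andbC !ffunE; case: (i == ord0); rewrite ?andbF //= ?subn0.
Qed.

End Quotient.
End Coefficients.

End Monomials.

(** * Divisibility by S and connectedness of the quotient's support *)

Section Vanishing.
Variables (n : nat) (R : realFieldType).
Implicit Types (m : mono n) (q f : mono n -> R).

Lemma kronecker_eq0 d q : homog d q ->
  (forall t, 0 < t -> (kronecker (monos n d) d.+1 q).[t] = 0) -> forall m, q m = 0.
Proof.
move=> hq van m; have [|//] := boolP (q m != 0); last by rewrite negbK => /eqP.
move=> qm.
have nz : kronecker (monos n d) d.+1 q != 0.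
  apply: contraNneq (qm) => e.
  by rewrite -(kronecker_coef q (homog_mem hq (leqnn d) qm)) e coef0.
by have [t t0] := poly_pos_nonroot nz; rewrite van ?eqxx.
Qed.

Lemma mulS_neq0_term q m : mulS q m != 0 -> exists2 i, (0 < m i)%N & q (subU m i) != 0.
Proof.
move=> nz.
have [/existsP[i /andP[mi qi]]|/existsPn none] :=
  boolP [exists i, (0 < m i)%N && (q (subU m i) != 0)]; first by exists i.
case/eqP: nz; apply: big1 => i mi; have := none i.
by rewrite mi negbK => /eqP.
Qed.

(* The remainder f - S q only involves X_1, ..., X_n, which are free on the hyperplane. *)
Lemma mulS_quo_vanishing d f : homog d f ->
  (forall x, S x = 0 -> \sum_(m <- monos n d) f m * \prod_(i < n.+1) x i ^+ m i = 0) ->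
  forall m, mulS (quo f) m = f m.
Proof.
move=> hf van.
have qh := quo_homog hf.
pose r m := f m - mulS (quo f) m.
have mh : homog d (mulS (quo f)).
  move=> m nz; have [i _ /(quo_rec_mdeg hf) e] := mulS_neq0_term nz.
  by rewrite (mulS_homog qh nz) prednK // -e.
have rh : homog d r.
  move=> m; have [/hf//|/negPn/eqP f0] := boolP (f m != 0).
  have [/mh//|/negPn/eqP g0] := boolP (mulS (quo f) m != 0).
  by rewrite /r f0 g0 subrr eqxx.
suff r0 m : r m = 0 by move=> m; apply/esym/eqP; rewrite -subr_eq0; apply/eqP/r0.
apply: (kronecker_eq0 rh) => t _.
(* A point of the hyperplane: the Kronecker values for i <> 0, and X_0 chosen to make the sum
   vanish. As r has no monomial divisible by X_0, its value here is its Kronecker polynomial at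
   t. *)
pose x (i : 'I_n.+1) : R := if i == ord0 then - \sum_(j < n.+1 | j != ord0) t ^+ (d.+1 ^ j)
  else t ^+ (d.+1 ^ i).
have Sx : S x = 0.
  rewrite /S (bigD1 ord0) //= {1}/x eqxx addrC; apply/eqP; rewrite subr_eq0; apply/eqP.
  by apply: eq_bigr => i /negbTE i0; rewrite /x i0.
have xE m' : r m' * t ^+ code d.+1 m' = r m' * \prod_(i < n.+1) x i ^+ m' i.
  have [m0|m0] := posnP (m' ord0); last first.
    by rewrite /r mulS_quo // subrr !mul0r.
  congr (_ * _); rewrite /code expr_sum; apply: eq_bigr => i _.
  by rewrite /x; case: eqVneq => [->|_]; rewrite ?m0 // mulnC exprM.
rewrite kronecker_horner (eq_bigr _ (fun m' _ => xE m')) /r.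
under eq_bigr do rewrite mulrBl.
rewrite sumrB van // sub0r; apply/eqP; rewrite oppr_eq0; apply/eqP.
(* For d = 0 the truncated degree [d.-1] is not one less than d, but then the quotient is zero. *)
case: (posnP d) => [d0|dp].
  apply: big1 => m' _; rewrite /mulS big1 ?mul0r // => i _.
  by apply/eqP; apply: contraTT isT => /(quo_rec_mdeg hf); rewrite d0.
by have := sum_mulS_eval x qh; rewrite prednK // Sx mulr0.
Qed.

(** Connectedness is stated by cuts rather than paths: this is what indecomposability yields, and
    cuts pull back along a projection. *)
Definition linked_support q := forall X : pred (mono n),
  (exists2 m, q m != 0 & X m) -> (exists2 m, q m != 0 & ~~ X m) ->
  exists m1 m2 i j, [/\ q m1 != 0, X m1, q m2 != 0, ~~ X m2 & addU m1 i = addU m2 j].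

(** If no link crosses the cut X, the parts of q inside and outside X have multiples by S without a
    common monomial, and these decompose P. *)
Lemma indecomposable_linked (P : mpoly R n) d q : homog d q ->
  (forall m, coef P m = mulS q m) -> indecomposable P -> linked_support q.
Proof.
move=> hq PE [_ indec] X [u qu Xu] [v qv Xv].
have [/hasP[m1 _ /hasP[m2 _ /existsP[i /existsP[j /and5P[h1 h2 h3 h4 /eqP h5]]]]]|/hasPn none] :=
  boolP (has (fun m1 => has (fun m2 => [exists i, exists j,
     [&& q m1 != 0, X m1, q m2 != 0, ~~ X m2 & addU m1 i == addU m2 j]]) (monos n d)) (monos n d)).
  by exists m1, m2, i, j.
case: indec.
pose q1 m := if X m then q m else 0; pose q2 m := if X m then 0 else q m.
have hq1 : homog d q1 by move=> m; rewrite /q1; case: (X m) => [/hq|]; rewrite ?eqxx.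
have hq2 : homog d q2 by move=> m; rewrite /q2; case: (X m) => [|/hq]; rewrite ?eqxx.
exists (mpoly_of (mulS_homog hq1)), (mpoly_of (mulS_homog hq2)); split.
- by split; apply: mulS_inI.
- by apply: (mulS_neq0 (m := u) hq1); rewrite /q1 Xu.
- by apply: (mulS_neq0 (m := v) hq2); rewrite /q2 (negbTE Xv).
- move=> m; rewrite PE /= /mulS -big_split /=; apply: eq_bigr => i _.
  by rewrite /q1 /q2; case: (X _); rewrite ?addr0 ?add0r.
move=> m /=; case: (eqVneq (mulS q1 m) 0) => [|/mulS_neq0_term[i mi n1]]; first by left.
case: (eqVneq (mulS q2 m) 0) => [|/mulS_neq0_term[j mj n2]]; first by right.
have m1 := homog_mem hq1 (leqnn d) n1; have m2 := homog_mem hq2 (leqnn d) n2.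
move: n1 n2; rewrite /q1 /q2; case: ifP => X1; rewrite ?eqxx // => n1.
case: ifP => X2; rewrite ?eqxx // => n2.
have /hasPn/(_ _ m2)/existsPn/(_ i)/existsPn/(_ j) := none _ m1.
by rewrite n1 n2 X1 X2 !subUK ?eqxx.
Qed.

End Vanishing.

(** * Merging variables *)

Section Merge.
Variables (n : nat) (R : realFieldType) (d : nat) (q : mono n -> R).
Hypotheses (q_homog : homog d q) (q_linked : linked_support q).
Variables (i0 j k : 'I_n.+1) (A B D : nat).
Hypotheses (jk : j != k) (i0j : i0 != j) (i0k : i0 != k).
Hypothesis q_bounds : forall m, q m != 0 -> [/\ A <= m j, B <= m k & m j + m k <= A + B + D]%N.
Hypothesis touchA : exists2 m, q m != 0 & m j = A.
Hypothesis touchB : exists2 m, q m != 0 & m k = B.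
Hypothesis touchD : exists2 m, q m != 0 & (m j + m k = A + B + D)%N.

(** Modulo D + 3 the integers 0, ..., D + 2 stay distinct, as [phi_inj] requires. *)
Let T : finZmodType := 'rV['Z_(D.+3)]_2.
Let e1 : T := delta_mx 0 0.
Let e2 : T := delta_mx 0 1.

Let phi_inj a b a' b' : (a <= D.+2)%N -> (b <= D.+2)%N -> (a' <= D.+2)%N ->
  (b' <= D.+2)%N -> phi e1 e2 a b = phi e1 e2 a' b' -> a = a' /\ b = b'.
Proof.
move=> ha hb ha' hb' /matrixP e.
have e0 : (a%:R : 'Z_(D.+3)) = a'%:R.
  by have := e 0 0; rewrite !mxE !mulmxnE !mxE /= !mul0rn !addr0.
have e3 : (b%:R : 'Z_(D.+3)) = b'%:R.
  by have := e 0 1; rewrite !mxE !mulmxnE !mxE /= !mul0rn !add0r.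
move: (congr1 (@nat_of_ord _) e0) (congr1 (@nat_of_ord _) e3).
by rewrite !val_Zp_nat // !modn_small.
Qed.

(** The shift by (A, B) is made in the group, not by truncated subtraction, so [proj_addU] holds for
    every m. *)
Let proj (m : mono n) : T := phi e1 e2 (m j) (m k) - phi e1 e2 A B.
Let step (i : 'I_n.+1) : T := phi e1 e2 (i == j) (i == k).

Let proj_addU m i : proj (addU m i) = proj m + step i.
Proof.
by rewrite /proj /step !ffunE [j == i]eq_sym [k == i]eq_sym -phiD addrAC.
Qed.

Let proj_phi m : q m != 0 -> proj m = phi e1 e2 (m j - A) (m k - B).
Proof.
move=> /q_bounds[hA hB _]; apply/eqP; rewrite subr_eq phiD !subnK //.
Qed.

Let fiber p m : R := if proj m == p then q m else 0.

(** The coefficient at p after projecting, as a polynomial in the weight parameter t. Distinct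
    monomials have distinct codes, so it is nonzero as soon as the fiber meets the support of q. *)
Let merged p : {poly R} := kronecker (monos n d) d.+1 (fiber p).

Let merged_neq0 m : q m != 0 -> merged (proj m) != 0.
Proof.
move=> qm; apply: contraNneq (qm) => e.
have := kronecker_coef (fiber (proj m)) (homog_mem q_homog (leqnn d) qm).
by rewrite -/(merged _) e coef0 /fiber eqxx => <-.
Qed.

Let generic : exists2 t : R, 0 < t & forall m, q m != 0 -> (merged (proj m)).[t] != 0.
Proof.
(* A non-root of the product keeps all these coefficients nonzero at once. *)
have : \prod_(p | merged p != 0) merged p != 0 by apply/prodf_neq0.
case/poly_pos_nonroot => t t0; rewrite horner_prod => /prodf_neq0 nz.
by exists t => // m /merged_neq0/nz.
Qed.

Lemma merged_bound (s : seq (mono n)) : (forall m, mulS q m != 0 -> m \in s) ->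
  (D + 6 <= (size s).*2)%N.
Proof.
move=> sP; have [t t0 tgen] := generic.
pose wt (m : mono n) := t ^+ code d.+1 m.
pose at_p p (m : mono n) : R := if proj m == p then wt m else 0.
pose f p := \sum_(m <- monos n d) q m * at_p p m.
pose g p := \sum_(m <- monos n d.+1) mulS q m * at_p p m.
have fE p : f p = (merged p).[t].
  rewrite /merged kronecker_horner; apply: eq_bigr => m _.
  by rewrite /at_p /fiber; case: ifP; rewrite ?mulr0 ?mul0r.
have f_proj m : q m != 0 -> proj m \in supp0 f by move=> /tgen; rewrite inE fE.
have supp_f p : p \in supp0 f -> exists2 m, q m != 0 & proj m = p.
  rewrite inE => nz.
  have [/hasP[m _ /andP[qm /eqP e]]|/hasPn none] :=
    boolP (has (fun m => (q m != 0) && (proj m == p)) (monos n d)); first by exists m.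
  case/eqP: nz; apply: big1_seq => m /andP[_ /none].
  by rewrite /at_p negb_and negbK => /orP[/eqP ->|/negbTE ->]; rewrite ?mul0r ?mulr0.
pose w (i : 'I_n.+1) := t ^+ (d.+1 ^ i).
have w0 i : 0 < w i by apply: exprn_gt0.
have gE p : g p = \sum_i w i * f (p - step i).
  rewrite /g (sum_mulS _ q_homog).
  under eq_bigr do rewrite big_distrr /=.
  rewrite exchange_big /=; apply: eq_bigr => i _.
  rewrite /f big_distrr /=; apply: eq_bigr => m _.
  rewrite mulrCA; congr (_ * _).
  rewrite /at_p proj_addU eq_sym -subr_eq eq_sym.
  by case: ifP => _; rewrite ?mulr0 // /wt code_addU exprD mulrC.
(* The variables other than X_j and X_k project to a zero step, so their weights add up; [i0] is one
   of them, whence positivity. *)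
pose s0 := \sum_(i | (i != j) && (i != k)) w i.
have s0_gt0 : 0 < s0.
  rewrite /s0 (bigD1 i0) ?i0j //=; apply: ltr_pwDl => //.
  by apply: sumr_ge0 => i _; apply: ltW.
have gE3 p : g p = s0 * f p + w j * f (p - e1) + w k * f (p - e2).
  rewrite gE (bigD1 j) //= (bigD1 k) //= 1?eq_sym // addrA addrC addrA.
  rewrite /step !eqxx (negbTE jk) [k == j]eq_sym (negbTE jk) /phi !mulr0n !addr0 !add0r.
  congr (_ + _ + _); rewrite /s0 big_distrl /=; apply: eq_bigr => i /andP[/negbTE ij /negbTE ik].
  by rewrite ij ik !mulr0n addr0 subr0.
have bnd := sparse_support_bound phi_inj s0_gt0 (w0 j) (w0 k) gE3.
(* Merging creates no terms: every point of the support of g is the projection of a monomial of S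
   q. *)
apply: (@leq_trans #|supp0 g|.*2); last first.
  rewrite leq_double -(size_map proj); apply: leq_trans (card_size _).
  apply: subset_leq_card; apply/subsetP => p; rewrite inE => nz.
  have [/hasP[m ms /eqP e]|/hasPn none] := boolP (has (fun m => proj m == p) s).
    by rewrite -e; apply: map_f.
  case/eqP: nz; apply: big1_seq => m /andP[_ _].
  have [/sP/none|/negPn/eqP ->] := boolP (mulS q m != 0); last by rewrite mul0r.
  by rewrite /at_p => /negbTE ->; rewrite mulr0.
apply: bnd.
- apply/subsetP => p /supp_f[m qm <-]; rewrite proj_phi //.
  by apply: phi_triangle; have [] := q_bounds qm; lia.
- move=> X [u /supp_f[mu qu eu] Xu] [v /supp_f[mv qv ev] Xv].
  have [||m1 [m2 [a [b [h1 h2 h3 h4 h5]]]]] := q_linked (X := X \o proj).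
  + by exists mu; rewrite //= eu.
  + by exists mv; rewrite //= ev.
  exists (proj m1), (proj m2), ((a == j : nat), (a == k : nat)), ((b == j : nat), (b == k : nat)).
  split; rewrite ?f_proj //; split.
  + by case: (eqVneq a j) => [->|_]; rewrite ?(negbTE jk); case: (_ == k).
  + by case: (eqVneq b j) => [->|_]; rewrite ?(negbTE jk); case: (_ == k).
  by rewrite -!/(step _) -!proj_addU h5.
- have [m qm mA] := touchA; exists (m k - B)%N; first by have [] := q_bounds qm; lia.
  by have := f_proj _ qm; rewrite proj_phi // mA subnn.
- have [m qm mB] := touchB; exists (m j - A)%N; first by have [] := q_bounds qm; lia.
  by have := f_proj _ qm; rewrite proj_phi // mB subnn.
have [m qm mD] := touchD; exists (m j - A)%N; first by have [] := q_bounds qm; lia.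
have := f_proj _ qm; rewrite proj_phi //.
by have -> : (m k - B = D - (m j - A))%N by have [] := q_bounds qm; lia.
Qed.

End Merge.

(** * Choice of the two variables and conclusion *)

Lemma support_min n (R : realFieldType) (q : mono n -> R) d (h : mono n -> nat) :
  homog d q -> (exists m, q m != 0) ->
  exists2 a, (exists2 m, q m != 0 & h m = a) & forall m, q m != 0 -> (a <= h m)%N.
Proof.
move=> hq [m0 q0].
pose Q k := has (fun m => (q m != 0) && (h m == k)) (monos n d).
have exQ : exists k, Q k.
  by exists (h m0); apply/hasP; exists m0; [apply: (homog_mem hq) | rewrite q0 eqxx].
case: (ex_minnP exQ) => k /hasP[m _ /andP[qm /eqP e]] kmin.
exists k; first by exists m.
move=> m' qm'; apply: kmin; apply/hasP; exists m'; first exact: (homog_mem hq).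
by rewrite qm' eqxx.
Qed.

(** Take j = 1, and k maximizing y over the n - 1 indices other than 0 and j. The sum is then at
    most y j + (n - 1) y k, and n - 1 >= 1. *)
Lemma sum_leq_two_terms n (y : 'I_n.+1 -> nat) : (2 <= n)%N -> y ord0 = 0%N ->
  exists j k, [/\ j != k, ord0 != j, ord0 != k &
    \sum_i y i <= n.-1 * (y j + y k)]%N.
Proof.
move=> n2 y0.
have h1 : (1 < n.+1)%N by lia.
have h2 : (2 < n.+1)%N by lia.
pose j := Ordinal h1.
pose rest := [pred i : 'I_n.+1 | (i != ord0) && (i != j)].
have r2 : rest (Ordinal h2) by [].
case: (arg_maxnP y r2) => k /andP[k0 kj] kmax.
exists j, k; split=> //; rewrite 1?eq_sym //.
rewrite (bigD1 ord0) //= y0 add0n (bigD1 j) //=.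
have card_rest : #|rest| = n.-1.
  have := cardC [pred i | (i == ord0) || (i == j)]; rewrite card_ord.
  have -> : #|[pred i : 'I_n.+1 | (i == ord0) || (i == j)]| = 2 by rewrite (card2 ord0 j).
  have -> : #|[predC [pred i : 'I_n.+1 | (i == ord0) || (i == j)]]| = #|rest|.
    by apply: eq_card => i; rewrite !inE negb_or.
  by rewrite add2n => - [h]; rewrite -[in RHS]h.
have bnd : (\sum_(i | (i != ord0) && (i != j)) y i <= n.-1 * y k)%N.
  rewrite -card_rest -sum_nat_const; apply: leq_sum => i; exact: kmax.
by rewrite mulnDr; apply: leq_add bnd; apply: leq_pmull; lia.
Qed.

(** X^a divides P, and the quotient, of degree e - [mdeg a], competes in the minimum defining the
    p-degree. *)
Lemma pdegree_le n (R : realFieldType) (P : mpoly R n) (d e : nat) (a : mono n) :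
  is_pdegree P d -> homog e (coef P) ->
  nonzero P -> (forall m, coef P m != 0 -> forall i, (a i <= m i)%N) ->
  (d + mdeg a <= e)%N.
Proof.
move=> [_ dmin] hP [m0 Pm0] aP.
pose up (m : mono n) : mono n := [ffun i => (m i + a i)%N].
pose down (m : mono n) : mono n := [ffun i => (m i - a i)%N].
have upK m : down (up m) = m by apply/ffunP => i; rewrite !ffunE addnK.
have ok m : coef P (up m) != 0 -> m \in map down (supp P).
  by move=> /supp_ok h; rewrite -(upK m) map_f.
have attained : pdeg_attained P (tdeg (MPoly ok)).
  exists a, (MPoly ok); split=> // m /=; case: ifP => [/forallP am|/forallP am].
    by congr (coef P _); apply/ffunP => i; rewrite !ffunE subnK.
  by apply/eqP; apply: contraT => /aP h.
have bound : (tdeg (MPoly ok) <= e - mdeg a)%N.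
  apply/bigmax_leqP_seq => m; rewrite mem_undup mem_filter /= => /andP[/hP <- _] _.
  have -> : mdeg (up m) = (mdeg m + mdeg a)%N.
    by rewrite /mdeg -big_split /=; apply: eq_bigr => i _; rewrite ffunE.
  by rewrite addnK.
have ae : (mdeg a <= e)%N by rewrite -(hP _ Pm0); apply: leq_sum => i _; apply: aP.
by have := leq_trans (dmin _ attained) bound; rewrite leq_subRL // addnC.
Qed.

Theorem mainTheorem17 (R : realFieldType) (n : nat) (P : mpoly R n) (d : nat) :
  (2 <= n)%N -> inI P -> nonzero P -> indecomposable P -> is_pdegree P d ->
  (d%:Z <= (n%:Z - 1) * (2 * (nterms P)%:Z - 5))%R.
Proof.
move=> n2 [[e Phom] Pvan] [m0 Pm0] indec pdeg.
have hP : homog e (coef P) by [].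
pose q := quo (coef P).
have PE m : mulS q m = coef P m.
  by apply: (mulS_quo_vanishing hP) => x /Pvan; rewrite (evalE x hP).
have hq : homog e.-1 q := quo_homog hP.
have [i1 _ qi1] : exists2 i, (0 < m0 i)%N & q (subU m0 i) != 0.
  by apply: mulS_neq0_term; rewrite PE.
have q0 : exists m, q m != 0 by exists (subU m0 i1).
have e0 : e.-1.+1 = e by rewrite prednK // -(quo_rec_mdeg hP qi1).
have lk : linked_support q by apply: (indecomposable_linked hq _ indec) => m; rewrite PE.
(* The least exponent of each variable in q; their monomial divides q, hence also P. *)
have /fin_all_exists[a0 aP] : forall i : 'I_n.+1, exists a, (exists2 m, q m != 0 & m i = a) /\
    forall m, q m != 0 -> (a <= m i)%N.
  by move=> i; have [a a1 a2] := support_min (fun m => m i) hq q0; exists a.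
pose a : mono n := [ffun i => a0 i].
have qa m i : q m != 0 -> (a i <= m i)%N by rewrite ffunE; apply: (aP i).2.
have dle : (d + mdeg a <= e)%N.
  apply: (pdegree_le pdeg hP) => [|m]; first by exists m0.
  rewrite -PE => /mulS_neq0_term[i mi qm] j.
  by apply: leq_trans (qa _ j qm) _; rewrite ffunE leq_subr.
(* With minimal X_0-exponent, w has reduced exponent 0 at X_0, so the two chosen variables differ
   from X_0. *)
have [w qw w0] := (aP ord0).1.
have [|j [k [jk j0 k0 sumle]]] := @sum_leq_two_terms n (fun i => w i - a i)%N n2.
  by rewrite w0 ffunE subnn.
(* [mB] maximizes the sum of the exponents of X_j and X_k, found by minimizing its complement to e -
   1. *)
have [B [mB qB eB] Bmin] := support_min (fun m => e.-1 - (m j + m k))%N hq q0.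
have wdeg : (\sum_i (w i - a i) + mdeg a = e.-1)%N.
  rewrite -(hq w qw) /mdeg -big_split /=; apply: eq_bigr => i _.
  by rewrite subnK // qa.
have two m : q m != 0 -> (m j + m k <= e.-1)%N.
  by move=> /hq <-; rewrite /mdeg (bigD1 j) //= (bigD1 k) 1?eq_sym //= addnA leq_addr.
pose D := (mB j + mB k - (a j + a k))%N.
have aB : (a j + a k <= mB j + mB k)%N by apply: leq_add; apply: qa.
have key : (D + 6 <= (nterms P).*2)%N.
  apply: (merged_bound hq lk jk j0 k0 (A := a j) (B := a k) (D := D)).
  - move=> m qm; split; [exact: qa | exact: qa | ].
    by rewrite subnKC //; have := Bmin m qm; have := two _ qm; have := two _ qB; lia.
  - by have [m qm mj] := (aP j).1; exists m; rewrite // ffunE.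
  - by have [m qm mk] := (aP k).1; exists m; rewrite // ffunE.
  - by exists mB; rewrite // subnKC.
  by move=> m; rewrite PE mem_undup mem_filter => Pm; rewrite Pm supp_ok.
have wD : (w j - a j + (w k - a k) <= D)%N.
  have := Bmin w qw; have := two _ qw; have := two _ qB.
  by have := qa w j qw; have := qa w k qw; rewrite /D; lia.
(* d is at most 1 plus the sum of the reduced exponents of w, hence at most 1 + (n - 1) D. The
   conclusion then follows from D + 1 <= 2 N(P) - 5. *)
have dN : (d <= n.-1 * (D + 1))%N.
  have : (d <= n.-1 * (w j - a j + (w k - a k)) + 1)%N by lia.
  by move: wD; set y := (_ + _)%N => wD; nia.
have n1 : (n = n.-1.+1)%N by rewrite prednK //; lia.
clear - dN key n1 n2.
move: dN key n1; move: (nterms P) n.-1 => N n' dN key ->.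
by nia.
Qed.
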